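(* Suppose $R_z<0$ on $I=[z_0,\infty)$ with $z_0>0$, and let $\xi_0>1/2$. Let $\xi$ be the solution on $I$ of $$\frac{d\xi}{dz}=\frac{\sqrt6\sqrt{1+\xi}}{1+z}+\xi\,\frac{R_z}{R}\left(\frac{\sqrt3\sqrt{1+\xi}}{\sqrt3-\sqrt{2+2\xi}}\right),\qquad \xi(z_0)=\xi_0,$$ and let $M[z]=R[z]\,\xi[z]$. Then, for $\rho=\sqrt{3/2}$, there are positive constants $c_3$ and $c_4$ so that on $I$ $$c_3\left((R[z])^{-(\rho-1)}+R[z]\ln\left(\frac{1+z}{1+z_0}\right)\right)\le M[z]\le c_4\left(\frac{1+\ln(1+z)}{(R[z])^{\rho-1/2}}\right)^2.$$
   Context: Setting: the Lemaître–Tolman–Bondi system with constant $E\equiv1$ and $\sigma=\operatorname{sgn}\partial_tR=1$, $\delta=\operatorname{sgn}\partial_rR=1$. The function $R[z]$ is a given smooth positive function of the redshift $z>0$, and $R_z=dR[z]/dz$. $M[z]$ is the value along the null geodesic of the unknown function $M$, and $\xi=M/R$; in this case the equation for $\xi$ decouples from those for the geodesic coordinates $(r,t)$ and is the differential equation displayed in the claim. *)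

(* Defs.v *)
(* Stdlib real numbers with Coquelicot. *)
From Stdlib Require Import Reals.
From Coquelicot Require Import Coquelicot.
Open Scope R_scope.

(* The divisor vanishes exactly at xi = 1/2 and the square roots are genuine
   for xi >= -1; a solution starting above 1/2 is increasing, so the totalised
   values of [/] and [sqrt] are never met along it. *)
Definition ltb_rhs (Rad : R -> R) (z xi : R) : R :=
  sqrt 6 * sqrt (1 + xi) / (1 + z)
  + xi * (Derive Rad z / Rad z)
    * (sqrt 3 * sqrt (1 + xi) / (sqrt 3 - sqrt (2 + 2 * xi))).

(* [D_in] is the derivative relative to a set, hence one-sided at the
   endpoint z0: nothing is required of xi to the left of z0. *)
Definition ltb_solution (Rad : R -> R) (z0 xi0 : R) (xi : R -> R) : Prop :=
  xi z0 = xi0 /\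
  forall z : R, z0 <= z ->
    D_in xi (fun x => ltb_rhs Rad x (xi x)) (fun x => z0 <= x) z.

Definition smooth_on_pos (f : R -> R) : Prop :=
  forall (n : nat) (z : R), 0 < z -> ex_derive_n f n z.

(* Main.v *)
Require Import Defs.
From Stdlib Require Import Reals.
From Coquelicot Require Import Coquelicot.
From Stdlib Require Import Lra.
Open Scope R_scope.

(** Put [rho = sqrt (3/2)], [s = sqrt (1 + xi)] and [q = - Rad' / Rad > 0].
    Since [sqrt 6 = 2 rho], [sqrt 3 = rho sqrt 2] and
    [sqrt (2 + 2 xi) = sqrt 2 * s], the equation reads
      [xi' = 2 rho s / (1 + z) + rho q xi s / (s - rho)],
    where [s > rho] means exactly [xi > 1/2].  Above [1/2] both terms are
    positive, so [xi] cannot drop below its initial value and the singular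
    locus [s = rho] stays at a positive distance.

    Lower bound.  Keeping only the first term gives [xi' >= 1 / (1 + z)], hence
    [xi >= ln ((1 + z) / (1 + z0))].  Keeping only the second and using
    [s / (s - rho) >= 1] gives [xi' >= rho q xi], so [xi Rad^rho] is
    nondecreasing.  Multiplying by [Rad] and averaging the two yields the claim.

    Upper bound.  In terms of [s] the equation is
      [s' = rho / (1 + z) + rho q (s^2 - 1) / (2 (s - rho))],
    and because [rho^2 - 1 = 1/2] the last quotient equals
    [s/2 + rho/2 + 1 / (4 (s - rho))], at most [(s + k) / 2] with
    [k = rho + 1 / (2 (s0 - rho))].  Therefore
      [((s + k) Rad^(rho/2))' <= rho Rad^(rho/2) / (1 + z)],
    and as [Rad] decreases, [s Rad^(rho/2) <= C (1 + ln (1 + z))].  Squaring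
    bounds [M <= Rad s^2] by a multiple of [(1 + ln (1 + z))^2 Rad^(1 - rho)],
    which is stronger than the claim by a factor [Rad^rho], bounded on the
    half-line. *)

(** * Calculus on a half-line *)

(** Continuing [f] affinely to the left of [a], with the slope it has there,
    turns one-sided differentiability at [a] into ordinary differentiability,
    so that the mean value theorem applies up to the endpoint. *)
Lemma D_in_half_line_extension (f d : R -> R) (a : R) :
  (forall x, a <= x -> D_in f d (fun y => a <= y) x) ->
  exists g : R -> R, forall x, a <= x -> g x = f x /\ is_derive g x (d x).
Proof.
intros Hd.
exists (fun x => if Rle_dec a x then f x else f a + d a * (x - a)).
intros x Hx; split.
{ destruct (Rle_dec a x); [reflexivity | lra]. }
apply is_derive_Reals; intros eps Heps.
destruct (Hd x Hx eps Heps) as [al [Hal Hlim]].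
assert (Hdel : exists del : posreal, del <= al /\ (a < x -> del <= x - a)).
{ destruct (Rle_lt_or_eq_dec a x Hx) as [Hlt | Heq].
  - assert (Hm : 0 < Rmin al (x - a)) by (apply Rmin_pos; lra).
    exists (mkposreal _ Hm); simpl; split; [apply Rmin_l | intros _; apply Rmin_r].
  - exists (mkposreal al Hal); simpl; split; lra. }
destruct Hdel as [del [Hdel1 Hdel2]].
exists del; intros h Hh Hhd.
destruct (Rle_dec a x) as [_ | ]; [ | lra].
destruct (Rle_dec a (x + h)) as [Hxh | Hxh].
- specialize (Hlim (x + h)).
  unfold R_dist in Hlim; simpl in Hlim; unfold R_dist in Hlim.
  replace (x + h - x) with h in Hlim by ring.
  apply Hlim; split; [split; [exact Hxh | lra] | lra].
- assert (Hax : a = x).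
  { destruct (Rle_lt_or_eq_dec a x Hx) as [Hlt | Heq]; [ | exact Heq].
    specialize (Hdel2 Hlt). apply Rabs_def2 in Hhd. lra. }
  subst x.
  replace ((f a + d a * (a + h - a) - f a) / h - d a) with 0 by (field; lra).
  rewrite Rabs_R0; exact Heps.
Qed.

Lemma derive_nonneg_le (f d : R -> R) (a x : R) :
  (forall y, a <= y -> is_derive f y (d y)) ->
  (forall y, a <= y -> 0 <= d y) ->
  a <= x -> f a <= f x.
Proof.
intros Hd Hpos Hax.
destruct (MVT_gen f a x d) as [c [Hc Heq]].
- intros y Hy; rewrite Rmin_left in Hy by lra. apply Hd; lra.
- intros y Hy; rewrite Rmin_left in Hy by lra.
  apply derivable_continuous_pt. exists (d y). apply is_derive_Reals, Hd; lra.
- rewrite Rmin_left in Hc by lra.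
  assert (0 <= d c * (x - a)) by (apply Rmult_le_pos; [apply Hpos | ]; lra).
  lra.
Qed.

(** The last point up to which [f] stays above [f a] cannot be interior: there
    [f >= f a] by continuity, and the positive derivative pushes [f] further
    up.  The sign of the derivative is assumed only where the barrier has not
    been crossed, which is all that is known of the equation beforehand. *)
Lemma derive_pos_barrier (f d : R -> R) (a x : R) :
  (forall y, a <= y -> is_derive f y (d y)) ->
  (forall y, a <= y -> f a <= f y -> 0 < d y) ->
  a <= x -> f a <= f x.
Proof.
intros Hd Hpos Hax.
pose (E := fun b => a <= b <= x /\ forall y, a <= y <= b -> f a <= f y).
assert (HEa : E a).
{ split; [lra | ]. intros y Hy; replace y with a by lra; lra. }
destruct (completeness E) as [b [Hub Hlub]].
{ exists x; intros b [Hb _]; lra. }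
{ exists a; exact HEa. }
assert (Hab : a <= b) by (apply Hub; exact HEa).
assert (Hbx : b <= x) by (apply Hlub; intros c [Hc _]; lra).
assert (Hbelow : forall y, a <= y < b -> f a <= f y).
{ intros y Hy. destruct (Rle_lt_dec (f a) (f y)) as [H | H]; [exact H | ].
  enough (b <= y) by lra.
  apply Hlub; intros c [Hc Hcy].
  destruct (Rle_lt_dec c y) as [Hcy' | Hcy']; [exact Hcy' | ].
  specialize (Hcy y); lra. }
assert (Hb : f a <= f b).
{ destruct (Rle_lt_or_eq_dec a b Hab) as [Hlt | <-]; [ | lra].
  destruct (Rle_lt_dec (f a) (f b)) as [H | H]; [exact H | ].
  assert (Hcont : continuity_pt f b).
  { apply derivable_continuous_pt. exists (d b). apply is_derive_Reals, Hd; lra. }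
  destruct (Hcont (f a - f b)) as [al [Hal Hc]]; [lra | ].
  pose (m := Rmin (al / 2) (b - a)).
  assert (Hm : 0 < m) by (apply Rmin_pos; lra).
  assert (Hm1 : m <= al / 2) by apply Rmin_l.
  assert (Hm2 : m <= b - a) by apply Rmin_r.
  specialize (Hc (b - m)); simpl in Hc; unfold R_dist in Hc.
  assert (Habs : Rabs (f (b - m) - f b) < f a - f b).
  { apply Hc; split; [split; [exact I | lra] | ].
    replace (b - m - b) with (- m) by ring.
    rewrite Rabs_Ropp, Rabs_pos_eq; lra. }
  apply Rabs_def2 in Habs.
  assert (f a <= f (b - m)) by (apply Hbelow; lra). lra. }
destruct (Rle_lt_or_eq_dec b x Hbx) as [Hlt | <-]; [exfalso | exact Hb].
assert (Hdb : 0 < d b) by (apply Hpos; assumption).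
assert (Hl : derivable_pt_lim f b (d b)) by (apply is_derive_Reals, Hd; lra).
destruct (Hl (d b) Hdb) as [del Hdel].
pose proof (cond_pos del) as Hdp.
pose (m := Rmin (del / 2) (x - b)).
assert (Hm : 0 < m) by (apply Rmin_pos; lra).
assert (Hm1 : m <= del / 2) by apply Rmin_l.
assert (Hm2 : m <= x - b) by apply Rmin_r.
enough (HE : E (b + m)) by (specialize (Hub _ HE); lra).
split; [lra | ]. intros y Hy.
destruct (Rtotal_order y b) as [H | [-> | H]].
- apply Hbelow; lra.
- exact Hb.
- specialize (Hdel (y - b)).
  replace (b + (y - b)) with y in Hdel by ring.
  assert (Habs : Rabs ((f y - f b) / (y - b) - d b) < d b).
  { apply Hdel; [lra | rewrite Rabs_pos_eq; lra]. }
  apply Rabs_def2 in Habs.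
  assert (0 < (f y - f b) / (y - b) * (y - b)) by (apply Rmult_lt_0_compat; lra).
  replace ((f y - f b) / (y - b) * (y - b)) with (f y - f b) in * by (field; lra).
  lra.
Qed.

(** [Rad^p] is the integrating factor that turns the linear differential
    inequalities with rate [- p * Rad' / Rad] into monotonicity statements. *)
Lemma is_derive_mult_Rpower (f Rad : R -> R) (p z df : R) :
  is_derive f z df -> ex_derive Rad z -> 0 < Rad z ->
  is_derive (fun x => f x * Rpower (Rad x) p) z
    ((df + p * (Derive Rad z / Rad z) * f z) * Rpower (Rad z) p).
Proof.
intros Hf HR Hpos; unfold Rpower.
auto_derive.
- repeat split; [exists df; exact Hf | exact HR | exact Hpos].
- change (Derive (fun x => Rad x) z) with (Derive Rad z).
  change (Derive (fun x => f x) z) with (Derive f z).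
  rewrite (is_derive_unique f z df Hf). field. lra.
Qed.

Lemma ln_quotient_nonneg (a z : R) :
  0 < a -> a <= z -> 0 <= ln ((1 + z) / (1 + a)).
Proof.
intros Ha Hz.
rewrite ln_div by lra.
assert (ln (1 + a) <= ln (1 + z)) by (apply ln_le; lra).
lra.
Qed.

(** * The equation in terms of [sqrt (1 + xi)] *)

Lemma sqrt_one_plus_gt (x : R) : 1 / 2 < x -> sqrt (3 / 2) < sqrt (1 + x).
Proof. intros Hx; apply sqrt_lt_1; lra. Qed.

Lemma ltb_rhs_factored (Rad : R -> R) (z x : R) :
  1 / 2 < x ->
  let rho := sqrt (3 / 2) in let s := sqrt (1 + x) in
  ltb_rhs Rad z x
  = 2 * rho * s / (1 + z) + rho * (- (Derive Rad z / Rad z)) * (x * s / (s - rho)).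
Proof.
intros Hx rho s.
assert (Hs : rho < s) by (apply sqrt_one_plus_gt; exact Hx).
assert (H2 : 0 < sqrt 2) by (apply sqrt_lt_R0; lra).
assert (E3 : sqrt 3 = rho * sqrt 2).
{ unfold rho; rewrite <- sqrt_mult by lra. f_equal; lra. }
assert (E6 : sqrt 6 = 2 * rho).
{ replace 6 with (2 * 2 * (3 / 2)) by lra.
  rewrite sqrt_mult, sqrt_square by lra. reflexivity. }
unfold ltb_rhs.
replace (2 + 2 * x) with (2 * (1 + x)) by ring.
rewrite (sqrt_mult 2 (1 + x)), E3, E6 by lra; fold s.
replace (rho * sqrt 2 * s / (rho * sqrt 2 - sqrt 2 * s))
  with (- (rho * s / (s - rho))).
2: { replace (rho * sqrt 2 - sqrt 2 * s) with (- (sqrt 2 * (s - rho))) by ring.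
     field. lra. }
unfold Rdiv; ring.
Qed.

Section Solution.

Variables (Rad xi : R -> R) (z0 : R).
Let rho := sqrt (3 / 2).
Let s z := sqrt (1 + xi z).

Hypothesis z0_pos : 0 < z0.
Hypothesis Rad_derivable : forall z, z0 <= z -> ex_derive Rad z.
Hypothesis Rad_pos : forall z, z0 <= z -> 0 < Rad z.
Hypothesis Rad_decr : forall z, z0 <= z -> Derive Rad z < 0.
Hypothesis xi0_gt : 1 / 2 < xi z0.
Hypothesis xi_sol : forall z, z0 <= z -> is_derive xi z (ltb_rhs Rad z (xi z)).

Lemma rho_sqr : rho * rho = 3 / 2.
Proof. apply sqrt_sqrt; lra. Qed.

Lemma rho_gt_1 : 1 < rho.
Proof. unfold rho; rewrite <- sqrt_1 at 1; apply sqrt_lt_1; lra. Qed.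

Lemma log_decay_pos (z : R) : z0 <= z -> 0 < - (Derive Rad z / Rad z).
Proof.
intros Hz. pose proof (Rad_pos z Hz). pose proof (Rad_decr z Hz).
replace (- (Derive Rad z / Rad z)) with (- Derive Rad z / Rad z) by (field; lra).
apply Rdiv_lt_0_compat; lra.
Qed.

Lemma Rad_le_init (z : R) : z0 <= z -> Rad z <= Rad z0.
Proof.
intros Hz. apply Ropp_le_cancel.
apply (derive_nonneg_le (fun x => - Rad x) (fun x => - Derive Rad x)); [ | | exact Hz].
- intros y Hy. apply (is_derive_opp Rad), Derive_correct, Rad_derivable, Hy.
- intros y Hy; specialize (Rad_decr y Hy); lra.
Qed.

(** Follows from [s >= 1] and [s / (s - rho) >= 1]. *)
Lemma ltb_rhs_lower (z x : R) :
  z0 <= z -> 1 / 2 < x ->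
  1 / (1 + z) + rho * (- (Derive Rad z / Rad z)) * x <= ltb_rhs Rad z x.
Proof.
intros Hz Hx.
rewrite ltb_rhs_factored by exact Hx; cbv zeta; fold rho.
pose proof (sqrt_one_plus_gt x Hx) as Hs; fold rho in Hs.
set (t := sqrt (1 + x)) in *.
pose proof rho_gt_1. pose proof (log_decay_pos z Hz) as Hq.
apply Rplus_le_compat.
- apply Rmult_le_compat_r; [left; apply Rinv_0_lt_compat; lra | nra].
- apply Rmult_le_compat_l; [apply Rmult_le_pos; lra | ].
  apply Rle_div_r; [lra | nra].
Qed.

Lemma ltb_rhs_pos (z x : R) : z0 <= z -> 1 / 2 < x -> 0 < ltb_rhs Rad z x.
Proof.
intros Hz Hx.
pose proof (ltb_rhs_lower z x Hz Hx). pose proof (log_decay_pos z Hz).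
pose proof rho_gt_1.
assert (0 < 1 / (1 + z)) by (apply Rdiv_lt_0_compat; lra).
assert (0 < rho * (- (Derive Rad z / Rad z)) * x)
  by (repeat apply Rmult_lt_0_compat; lra).
lra.
Qed.

Lemma xi_ge_init (z : R) : z0 <= z -> xi z0 <= xi z.
Proof.
apply (derive_pos_barrier _ (fun x => ltb_rhs Rad x (xi x))); [exact xi_sol | ].
intros y Hy Hxy; apply ltb_rhs_pos; lra.
Qed.

(** * Lower bounds *)

Lemma xi_ge_power (z : R) :
  z0 <= z -> xi z0 * Rpower (Rad z0) rho <= xi z * Rpower (Rad z) rho.
Proof.
apply (derive_nonneg_le (fun x => xi x * Rpower (Rad x) rho)
  (fun x => (ltb_rhs Rad x (xi x) + rho * (Derive Rad x / Rad x) * xi x)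
            * Rpower (Rad x) rho)).
- intros y Hy; apply is_derive_mult_Rpower; auto.
- intros y Hy.
  apply Rmult_le_pos; [ | left; apply exp_pos].
  pose proof (xi_ge_init y Hy).
  assert (0 < 1 / (1 + y)) by (apply Rdiv_lt_0_compat; lra).
  pose proof (ltb_rhs_lower y (xi y) Hy ltac:(lra)). lra.
Qed.

Lemma xi_ge_log (z : R) : z0 <= z -> ln ((1 + z) / (1 + z0)) <= xi z.
Proof.
intros Hz. rewrite ln_div by lra.
enough (xi z0 - ln (1 + z0) <= xi z - ln (1 + z)) by lra.
apply (derive_nonneg_le (fun x => xi x - ln (1 + x))
  (fun x => ltb_rhs Rad x (xi x) - 1 / (1 + x))); [ | | exact Hz].
- intros y Hy. apply (is_derive_minus xi (fun x => ln (1 + x))); [auto | ].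
  auto_derive; [lra | field; lra].
- intros y Hy. pose proof (xi_ge_init y Hy).
  pose proof (ltb_rhs_lower y (xi y) Hy ltac:(lra)).
  pose proof (log_decay_pos y Hy). pose proof rho_gt_1.
  assert (0 <= rho * (- (Derive Rad y / Rad y)) * xi y)
    by (repeat apply Rmult_le_pos; lra).
  lra.
Qed.

Lemma mass_lower_bound (z : R) :
  z0 <= z ->
  Rmin 1 (xi z0 * Rpower (Rad z0) rho) / 2
    * (Rpower (Rad z) (- (rho - 1)) + Rad z * ln ((1 + z) / (1 + z0)))
  <= Rad z * xi z.
Proof.
intros Hz.
pose proof (Rad_pos z Hz) as HR.
pose proof (xi_ge_power z Hz) as Hp. pose proof (xi_ge_log z Hz) as Hl.
pose proof (ln_quotient_nonneg z0 z z0_pos Hz) as Hln.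
set (L := ln ((1 + z) / (1 + z0))) in *.
set (A := xi z0 * Rpower (Rad z0) rho) in *.
assert (HA : 0 < A) by (apply Rmult_lt_0_compat; [lra | apply exp_pos]).
set (c := Rmin 1 A).
assert (Hc : 0 < c) by (apply Rmin_pos; lra).
assert (c <= 1) by apply Rmin_l.
assert (c <= A) by apply Rmin_r.
assert (HX : c * Rpower (Rad z) (- (rho - 1)) <= Rad z * xi z).
{ set (P := Rpower (Rad z) (- (rho - 1))).
  assert (HP : 0 < P) by apply exp_pos.
  assert (HPR : Rpower (Rad z) rho * P = Rad z).
  { unfold P; rewrite <- Rpower_plus.
    replace (rho + - (rho - 1)) with 1 by ring. apply Rpower_1, HR. }
  apply Rle_trans with (xi z * Rpower (Rad z) rho * P); [nra | ].
  right. rewrite Rmult_assoc, HPR. ring. }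
assert (HY : c * (Rad z * L) <= Rad z * xi z).
{ assert (0 <= Rad z * L) by (apply Rmult_le_pos; lra). nra. }
lra.
Qed.

(** * Upper bound *)

(** [s' = xi' / (2 s)]; since [rho^2 - 1 = 1/2], the coefficient
    [(s^2 - 1) / (2 (s - rho))] of [rho q] is
    [s/2 + rho/2 + 1 / (4 (s - rho))], and [s >= s z0]. *)
Lemma s_derivative_bound (z : R) :
  z0 <= z ->
  exists ds, is_derive s z ds /\
    ds <= rho / (1 + z)
          + rho / 2 * (- (Derive Rad z / Rad z))
            * (s z + (rho + 1 / (2 * (s z0 - rho)))).
Proof.
intros Hz.
pose proof (xi_ge_init z Hz) as Hxi.
assert (Hs0 : rho < s z0) by (apply sqrt_one_plus_gt; exact xi0_gt).
assert (Hss : s z0 <= s z) by (apply sqrt_le_1; lra).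
assert (Hx : 1 / 2 < xi z) by lra.
pose proof rho_gt_1. pose proof rho_sqr as Hrho.
assert (Hsq : s z * s z = 1 + xi z) by (apply sqrt_sqrt; lra).
exists (ltb_rhs Rad z (xi z) / (2 * s z)); split.
- unfold s at 1. auto_derive.
  + split; [exists (ltb_rhs Rad z (xi z)); auto | lra].
  + change (Derive (fun x => xi x) z) with (Derive xi z).
    rewrite (is_derive_unique xi z _ (xi_sol z Hz)); fold (s z).
    field. lra.
- rewrite ltb_rhs_factored by exact Hx; cbv zeta; fold rho (s z).
  pose proof (log_decay_pos z Hz) as Hq.
  set (q := - (Derive Rad z / Rad z)) in *.
  replace ((2 * rho * s z / (1 + z) + rho * q * (xi z * s z / (s z - rho))) / (2 * s z))
    with (rho / (1 + z) + rho / 2 * q * (s z + (rho + 1 / (2 * (s z - rho))))).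
  2: { replace (s z + (rho + 1 / (2 * (s z - rho)))) with (xi z / (s z - rho)).
       - field; lra.
       - apply (Rmult_eq_reg_r (2 * (s z - rho))); [ | lra].
         field_simplify; [nra | lra | lra]. }
  apply Rplus_le_compat_l, Rmult_le_compat_l; [apply Rmult_le_pos; lra | ].
  do 2 apply Rplus_le_compat_l.
  apply Rmult_le_compat_l; [lra | ].
  apply Rinv_le_contravar; lra.
Qed.

(** [Rad <= Rad z0] bounds [((s + k) Rad^(rho/2))'] by
    [rho (Rad z0)^(rho/2) / (1 + z)], the derivative of a multiple of
    [ln (1 + z)]. *)
Lemma s_upper_bound :
  exists C, 0 < C /\
    forall z, z0 <= z -> s z * Rpower (Rad z) (rho / 2) <= C * (1 + ln (1 + z)).
Proof.
pose proof rho_gt_1.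
assert (Hs0 : rho < s z0) by (apply sqrt_one_plus_gt; exact xi0_gt).
set (k := rho + 1 / (2 * (s z0 - rho))).
assert (Hk : 0 < k).
{ assert (0 < 1 / (2 * (s z0 - rho))) by (apply Rdiv_lt_0_compat; lra).
  unfold k; lra. }
set (P z := Rpower (Rad z) (rho / 2)).
assert (HP : forall z, 0 < P z) by (intros z; apply exp_pos).
assert (Hmono : forall z, z0 <= z ->
  rho * P z0 * ln (1 + z0) - (s z0 + k) * P z0
  <= rho * P z0 * ln (1 + z) - (s z + k) * P z).
{ intros z.
  apply (derive_nonneg_le (fun x => rho * P z0 * ln (1 + x) - (s x + k) * P x)
    (fun x => rho * P z0 / (1 + x)
       - (Derive s x + rho / 2 * (Derive Rad x / Rad x) * (s x + k)) * P x)).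
  - intros y Hy.
    apply (is_derive_minus (fun x => rho * P z0 * ln (1 + x))
                           (fun x => (s x + k) * P x)).
    + auto_derive; [lra | field; lra].
    + apply (is_derive_mult_Rpower (fun x => s x + k)); auto.
      destruct (s_derivative_bound y Hy) as [ds [Hds _]].
      rewrite (is_derive_unique s y ds Hds).
      rewrite <- (Rplus_0_r ds).
      apply (is_derive_plus s (fun _ => k)); [exact Hds | apply @is_derive_const].
  - intros y Hy.
    destruct (s_derivative_bound y Hy) as [ds [Hds Hle]]; fold k in Hle.
    rewrite (is_derive_unique s y ds Hds).
    assert (HPy : P y <= P z0).
    { apply Rle_Rpower_l; [lra | ].
      split; [apply Rad_pos, Hy | apply Rad_le_init, Hy]. }
    assert (Hr : 0 < rho / (1 + y)) by (apply Rdiv_lt_0_compat; lra).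
    apply Rle_trans with (rho / (1 + y) * P z0 - rho / (1 + y) * P y); [nra | ].
    replace (rho * P z0 / (1 + y)) with (rho / (1 + y) * P z0) by (field; lra).
    apply Rplus_le_compat_l, Ropp_le_contravar, Rmult_le_compat_r;
      [left; apply HP | lra]. }
exists ((s z0 + k + rho) * P z0); split.
{ apply Rmult_lt_0_compat; [lra | apply HP]. }
intros z Hz; fold (P z).
pose proof (Hmono z Hz) as Hm.
pose proof (HP z). pose proof (HP z0).
assert (Hln0 : 0 <= ln (1 + z0)) by (rewrite <- ln_1; apply ln_le; lra).
assert (Hln1 : 0 <= ln (1 + z)) by (rewrite <- ln_1; apply ln_le; lra).
assert (0 <= rho * P z0 * ln (1 + z0)) by (repeat apply Rmult_le_pos; lra).
assert (0 <= (s z0 + k) * P z0 * ln (1 + z)) by (repeat apply Rmult_le_pos; lra).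
assert (0 <= k * P z) by (apply Rmult_le_pos; lra).
assert (0 <= rho * P z0) by (apply Rmult_le_pos; lra).
lra.
Qed.

(** [Rad xi <= Rad s^2 <= C^2 (1 + ln (1 + z))^2 Rad^(1 - rho)], and the
    surplus factor [Rad^rho] relative to the exponent [1 - 2 rho] is at most
    its value at [z0]. *)
Lemma mass_upper_bound :
  exists c, 0 < c /\
    forall z, z0 <= z ->
      Rad z * xi z <= c * ((1 + ln (1 + z)) / Rpower (Rad z) (rho - 1 / 2)) ^ 2.
Proof.
destruct s_upper_bound as [C [HC Hs]].
pose proof rho_gt_1.
set (B := Rpower (Rad z0) rho).
assert (HB : 0 < B) by apply exp_pos.
exists (C ^ 2 * B); split.
{ apply Rmult_lt_0_compat; [apply pow_lt | ]; assumption. }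
intros z Hz.
pose proof (Rad_pos z Hz) as HR.
specialize (Hs z Hz).
pose proof (xi_ge_init z Hz).
assert (Hsq : s z ^ 2 = 1 + xi z).
{ simpl; rewrite Rmult_1_r; apply sqrt_sqrt; lra. }
set (L := 1 + ln (1 + z)) in *.
set (Q := Rpower (Rad z) (rho - 1 / 2)).
set (P := Rpower (Rad z) (rho / 2)) in *.
assert (HQ : 0 < Q) by apply exp_pos.
assert (HP : 0 < P) by apply exp_pos.
assert (EQ : Rad z * Q ^ 2 = P ^ 2 * Rpower (Rad z) rho).
{ rewrite <- (Rpower_1 (Rad z) HR) at 1.
  unfold P, Q; simpl; rewrite !Rmult_1_r, <- !Rpower_plus.
  f_equal; lra. }
assert (HRB : Rpower (Rad z) rho <= B).
{ apply Rle_Rpower_l; [lra | ].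
  split; [exact HR | apply Rad_le_init, Hz]. }
replace (C ^ 2 * B * (L / Q) ^ 2) with ((C * L) ^ 2 * B / Q ^ 2) by (field; lra).
apply (Rle_div_r _ _ (Q ^ 2)); [apply pow_lt, HQ | ].
assert (Hpow : (s z * P) ^ 2 <= (C * L) ^ 2).
{ apply pow_incr; split; [ | exact Hs].
  apply Rmult_le_pos; [apply sqrt_pos | lra]. }
apply Rle_trans with ((s z * P) ^ 2 * Rpower (Rad z) rho).
- replace (Rad z * xi z * Q ^ 2) with (xi z * (Rad z * Q ^ 2)) by ring.
  replace ((s z * P) ^ 2 * Rpower (Rad z) rho)
    with (s z ^ 2 * (Rad z * Q ^ 2)) by (rewrite EQ; ring).
  apply Rmult_le_compat_r; [ | lra].
  apply Rmult_le_pos; [lra | apply pow2_ge_0].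
- apply Rmult_le_compat; [apply pow2_ge_0 | left; apply exp_pos | | ]; assumption.
Qed.

End Solution.

Theorem theorem2 (Rad : R -> R)
  (Rad_smooth : smooth_on_pos Rad)
  (Rad_pos : forall z : R, 0 < z -> 0 < Rad z)
  (z0 : R) (z0_pos : 0 < z0)
  (Rad_decr : forall z : R, z0 <= z -> Derive Rad z < 0)
  (xi0 : R) (xi0_gt : 1 / 2 < xi0)
  (xi : R -> R) (xi_sol : ltb_solution Rad z0 xi0 xi)
  (M : R -> R) (M_def : forall z : R, z0 <= z -> M z = Rad z * xi z)
  (rho : R) (rho_def : rho = sqrt (3 / 2)) :
  exists c3 c4 : R, 0 < c3 /\ 0 < c4 /\
    forall z : R, z0 <= z ->
      c3 * (Rpower (Rad z) (- (rho - 1))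
            + Rad z * ln ((1 + z) / (1 + z0))) <= M z /\
      M z <= c4 * ((1 + ln (1 + z)) / Rpower (Rad z) (rho - 1 / 2)) ^ 2.
Proof.
destruct xi_sol as [Hinit Hsol].
destruct (D_in_half_line_extension _ _ _ Hsol) as [g Hg].
assert (Hg0 : g z0 = xi0) by (rewrite (proj1 (Hg z0 (Rle_refl z0))); exact Hinit).
assert (Hgt : 1 / 2 < g z0) by lra.
assert (Hgsol : forall z, z0 <= z -> is_derive g z (ltb_rhs Rad z (g z))).
{ intros z Hz; destruct (Hg z Hz) as [E D]; rewrite E; exact D. }
assert (HR : forall z, z0 <= z -> 0 < Rad z) by (intros; apply Rad_pos; lra).
assert (HD : forall z, z0 <= z -> ex_derive Rad z).
{ intros z Hz; apply (Rad_smooth 1%nat z); lra. }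
destruct (mass_upper_bound Rad g z0 z0_pos HD HR Rad_decr Hgt Hgsol)
  as [c4 [Hc4 Hup]].
pose proof (mass_lower_bound Rad g z0 z0_pos HD HR Rad_decr Hgt Hgsol) as Hlow.
rewrite <- rho_def in Hup, Hlow.
exists (Rmin 1 (g z0 * Rpower (Rad z0) rho) / 2), c4.
split; [ | split; [exact Hc4 | ]].
- apply Rdiv_lt_0_compat; [ | lra].
  apply Rmin_pos; [lra | ].
  apply Rmult_lt_0_compat; [lra | apply exp_pos].
- intros z Hz. rewrite (M_def z Hz), <- (proj1 (Hg z Hz)).
  split; [apply Hlow, Hz | apply Hup, Hz].
Qed.
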